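(* Let $a,b>0$, $r\in\mathbb{R}$ and $0\le v\le 1$. Define $$g_{r,v}(a,b)= v\left(\frac{b-a}{a}\right)\left\{r\left(\frac{a+b}{2a}\right)^{v-1}+(1-r)\right\}+1,$$ $$G_{r,v}(a,b)=\frac{v}{2}\left(\frac{b-a}{a}\right)\left\{r a^{1-v}b^{v-1}+2-r\right\}+1.$$ (1) If either ($a\le b$ and $r\ge 0$) or ($b\le a$ and $r\le 0$), then $$g_{r,v}(a,b)\le F_{r,v}(a,b)\le G_{r,v}(a,b).$$ (2) If either ($a\le b$ and $r\le 0$) or ($b\le a$ and $r\ge 0$), then $$G_{r,v}(a,b)\le F_{r,v}(a,b)\le g_{r,v}(a,b).$$
   Context: The family of Heron means of two positive numbers $a$ and $b$ is defined, for $0\le v\le 1$ and $r\in\mathbb{R}$, by $$F_{r,v}(a,b)=r a^{1-v}b^v+(1-r)\{(1-v)a+vb\}.$$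
   Formalization: The printed inequalities fail at a=b=2 (F=2 but g=G=1), since F is homogeneous of degree 1 and g, G of degree 0; the formal theorem compares F with a·g and a·G instead, i.e. a·g ≤ F ≤ a·G in (1) and a·G ≤ F ≤ a·g in (2), agreeing with the text when a=1. *)

(* Defs.v *)
From Stdlib Require Import Reals.
Local Open Scope R_scope.

(* Real powers are [Rpower x y = exp (y * ln x)]; every base below is positive
   as soon as [a] and [b] are. *)

Definition heron_mean (r v a b : R) : R :=
  r * (Rpower a (1 - v) * Rpower b v) + (1 - r) * ((1 - v) * a + v * b).

(* Unlike [heron_mean], which is homogeneous of degree 1 in [(a, b)], the
   functions [g_bound] and [G_bound] depend only on the ratio [b / a]: the mean
   they are compared with is [heron_mean r v 1 (b / a) = heron_mean r v a b / a],
   hence a factor [a] is needed to compare them with [heron_mean r v a b]. *)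

Definition g_bound (r v a b : R) : R :=
  v * ((b - a) / a) * (r * Rpower ((a + b) / (2 * a)) (v - 1) + (1 - r)) + 1.

Definition G_bound (r v a b : R) : R :=
  v / 2 * ((b - a) / a) * (r * (Rpower a (1 - v) * Rpower b (v - 1)) + 2 - r) + 1.

(* Main.v *)
Require Import Defs.
From Stdlib Require Import Reals.
From Stdlib Require Import Lra.
Local Open Scope R_scope.

(** Both bounds are the Hermite-Hadamard inequality in disguise.  After
    cancelling the terms linear in [b - a], one finds
    [F - a * g = r * a^(1-v) * (b^v - a^v - v (b-a) ((a+b)/2)^(v-1))] and
    [F - a * G = r * a^(1-v) * (b^v - a^v - v (b-a) (a^(v-1) + b^(v-1))/2)],
    where [F] is the Heron mean.  The two brackets compare the integral of
    [v x^(v-1)] from [a] to [b] with its midpoint and trapezoid approximations.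
    Since [v - 1 <= 0], the integrand is convex, so for [a <= b] the first
    bracket is nonnegative and the second nonpositive; both change sign when
    [a] and [b] are exchanged.  The sign of [r] then selects which of the two
    bounds is the lower one.

    Convexity enters only as the tangent line inequality
    [Rpower_tangent_line], and the integral only through the primitive [x^v]
    ([hermite_hadamard]). *)

Lemma le_of_derive_nonneg (f df : R -> R) (a b : R) :
  a <= b ->
  (forall x, a <= x <= b -> derivable_pt_lim f x (df x)) ->
  (forall x, a <= x <= b -> 0 <= df x) ->
  f a <= f b.
Proof.
intros [Hab | ->] Hf Hpos; [|lra].
destruct (MVT_cor2 f df a b Hab Hf) as (c & Hc & Hac).
assert (0 <= df c) by (apply Hpos; lra).
assert (0 <= df c * (b - a)) by (apply Rmult_le_pos; lra).
lra.
Qed.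

(** Hermite-Hadamard for an integrand [f] with primitive [F], convexity being
    expressed by the position of the graph above its tangents.  The left
    inequality integrates the tangent at the midpoint [m], whose slope
    contributes nothing because [(b - m)^2 = (a - m)^2].  For the right one,
    the error of the trapezoid rule on [[a, x]] has as derivative half the gap,
    at [a], between [f] and its tangent at [x]. *)
Lemma hermite_hadamard (F f df : R -> R) (a b : R) :
  a <= b ->
  (forall x, a <= x <= b -> derivable_pt_lim F x (f x)) ->
  (forall x, a <= x <= b -> derivable_pt_lim f x (df x)) ->
  (forall x y, a <= x <= b -> a <= y <= b -> f x + df x * (y - x) <= f y) ->
  (b - a) * f ((a + b) / 2) <= F b - F a <= (b - a) * ((f a + f b) / 2).
Proof.
intros Hab HF Hf Htan; split.
- set (m := (a + b) / 2).
  pose (T := fun x => F x - (f m * x + df m / 2 * ((x - m) * (x - m)))).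
  assert (HT : T a <= T b).
  { apply (le_of_derive_nonneg T (fun x => f x - (f m + df m * (x - m))));
      [exact Hab | |].
    - intros x Hx. unfold T.
      apply derivable_pt_lim_minus with (f1 := F); [now apply HF|].
      replace (f m + df m * (x - m))
        with (f m * 1 + df m / 2 * ((1 - 0) * (x - m) + (x - m) * (1 - 0)))
        by field.
      assert (Hid : derivable_pt_lim (fun y => y - m) x (1 - 0)).
      { apply (derivable_pt_lim_minus id (fct_cte m)).
        - apply derivable_pt_lim_id.
        - apply derivable_pt_lim_const. }
      apply (derivable_pt_lim_plus (mult_real_fct (f m) id)
               (mult_real_fct (df m / 2) (fun y => (y - m) * (y - m)))).
      + apply derivable_pt_lim_scal, derivable_pt_lim_id.
      + apply derivable_pt_lim_scal.
        now apply (derivable_pt_lim_mult (fun y => y - m) (fun y => y - m)).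
    - intros x Hx.
      assert (Hm : a <= m <= b) by (unfold m; lra).
      specialize (Htan m x Hm Hx); lra. }
  assert (Hsym : T b - T a = F b - F a - (b - a) * f m)
    by (unfold T, m; field).
  lra.
- pose (E := fun x => / 2 * ((x - a) * (f a + f x)) - F x).
  assert (HE : E a <= E b).
  { apply (le_of_derive_nonneg E
             (fun x => / 2 * (f a - (f x + df x * (a - x)))));
      [exact Hab | |].
    - intros x Hx. unfold E.
      replace (/ 2 * (f a - (f x + df x * (a - x))))
        with (/ 2 * ((1 - 0) * (f a + f x) + (x - a) * (0 + df x)) - f x)
        by field.
      apply (derivable_pt_lim_minus
               (mult_real_fct (/ 2) (fun y => (y - a) * (f a + f y))) F);
        [|now apply HF].
      apply derivable_pt_lim_scal.
      apply (derivable_pt_lim_mult (fun y => y - a) (fun y => f a + f y)).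
      + apply (derivable_pt_lim_minus id (fct_cte a)).
        * apply derivable_pt_lim_id.
        * apply derivable_pt_lim_const.
      + apply (derivable_pt_lim_plus (fct_cte (f a)) f);
          [apply derivable_pt_lim_const | now apply Hf].
    - intros x Hx.
      assert (Ha : a <= a <= b) by lra.
      specialize (Htan x a Hx Ha); lra. }
  unfold E in HE; lra.
Qed.

Lemma ln_le_sub_1 (u : R) : 0 < u -> ln u <= u - 1.
Proof.
intros Hu.
pose proof (exp_ineq1_le (ln u)) as H.
rewrite (exp_ln u Hu) in H; lra.
Qed.

(** With [u = y / x] this is [u^s >= 1 + s (u - 1)], which for [s <= 0] is the
    chain [u^s = exp (s ln u) >= 1 + s ln u >= 1 + s (u - 1)]. *)
Lemma Rpower_tangent_line (s x y : R) :
  s <= 0 -> 0 < x -> 0 < y ->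
  Rpower x s + s * Rpower x (s - 1) * (y - x) <= Rpower y s.
Proof.
intros Hs Hx Hy.
assert (Hu : 0 < y / x) by now apply Rdiv_lt_0_compat.
assert (Hxs : Rpower x s = x * Rpower x (s - 1)).
{ rewrite <- (Rpower_1 x Hx) at 2.
  rewrite <- Rpower_plus; f_equal; ring. }
assert (Hys : Rpower y s = Rpower x s * Rpower (y / x) s).
{ rewrite Rpower_mult_distr by assumption.
  f_equal; field; lra. }
assert (Hlin : 1 + s * (y / x - 1) <= Rpower (y / x) s).
{ pose proof (exp_ineq1_le (s * ln (y / x))) as Hexp.
  pose proof (Rmult_le_compat_neg_l s _ _ Hs (ln_le_sub_1 _ Hu)).
  unfold Rpower; lra. }
apply (Rmult_le_compat_l (Rpower x s)) in Hlin;
  [|left; apply exp_pos].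
rewrite <- Hys in Hlin.
replace (Rpower x s + s * Rpower x (s - 1) * (y - x))
  with (Rpower x s * (1 + s * (y / x - 1))); [exact Hlin|].
rewrite Hxs; field; lra.
Qed.

Lemma Rpower_sub_bounds (a b v : R) :
  0 < a -> a <= b -> 0 <= v <= 1 ->
  (b - a) * (v * Rpower ((a + b) / 2) (v - 1)) <= Rpower b v - Rpower a v
  <= (b - a) * ((v * Rpower a (v - 1) + v * Rpower b (v - 1)) / 2).
Proof.
intros Ha Hab Hv.
apply (hermite_hadamard (fun x => Rpower x v)
         (fun x => v * Rpower x (v - 1))
         (fun x => v * ((v - 1) * Rpower x (v - 1 - 1)))); [exact Hab | | |].
- intros x Hx; apply derivable_pt_lim_power; lra.
- intros x Hx.
  apply (derivable_pt_lim_scal (fun y => Rpower y (v - 1))).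
  apply derivable_pt_lim_power; lra.
- intros x y Hx Hy.
  assert (Ht : Rpower x (v - 1) + (v - 1) * Rpower x (v - 1 - 1) * (y - x)
               <= Rpower y (v - 1)) by (apply Rpower_tangent_line; lra).
  apply (Rmult_le_compat_l v) in Ht; lra.
Qed.

Lemma heron_sub_g_bound (a b r v : R) :
  0 < a -> 0 < b ->
  heron_mean r v a b - a * g_bound r v a b
  = r * (Rpower a (1 - v) *
         (Rpower b v - Rpower a v
          - (b - a) * (v * Rpower ((a + b) / 2) (v - 1)))).
Proof.
intros Ha Hb; unfold heron_mean, g_bound.
assert (Hmid : Rpower ((a + b) / (2 * a)) (v - 1)
               = Rpower a (1 - v) * Rpower ((a + b) / 2) (v - 1)).
{ replace (Rpower a (1 - v)) with (Rpower (/ a) (v - 1)).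
  - rewrite Rpower_mult_distr; [f_equal; field; lra | | lra].
    now apply Rinv_0_lt_compat.
  - unfold Rpower; rewrite ln_Rinv by exact Ha; f_equal; ring. }
assert (Haa : Rpower a (1 - v) * Rpower a v = a).
{ rewrite <- Rpower_plus.
  replace (1 - v + v) with 1 by ring; now apply Rpower_1. }
rewrite Hmid.
(* Once [a^(1-v) a^v] is replaced by [a], the identity is rational in [a], [b],
   [v] and the remaining powers. *)
rewrite !(Rmult_minus_distr_l (Rpower a (1 - v))), Haa.
field; lra.
Qed.

Lemma heron_sub_G_bound (a b r v : R) :
  0 < a -> 0 < b ->
  heron_mean r v a b - a * G_bound r v a b
  = r * (Rpower a (1 - v) *
         (Rpower b v - Rpower a v
          - (b - a) * ((v * Rpower a (v - 1) + v * Rpower b (v - 1)) / 2))).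
Proof.
intros Ha Hb; unfold heron_mean, G_bound.
assert (Haa : Rpower a (1 - v) * Rpower a v = a).
{ rewrite <- Rpower_plus.
  replace (1 - v + v) with 1 by ring; now apply Rpower_1. }
assert (Ha1 : Rpower a (1 - v) * Rpower a (v - 1) = 1).
{ rewrite <- Rpower_plus.
  replace (1 - v + (v - 1)) with 0 by ring; now apply Rpower_O. }
replace (Rpower a (1 - v) *
         (Rpower b v - Rpower a v
          - (b - a) * ((v * Rpower a (v - 1) + v * Rpower b (v - 1)) / 2)))
  with (Rpower a (1 - v) * Rpower b v - Rpower a (1 - v) * Rpower a v
        - (b - a) * (v / 2)
          * (Rpower a (1 - v) * Rpower a (v - 1)
             + Rpower a (1 - v) * Rpower b (v - 1))) by field.
rewrite Haa, Ha1.
field; lra.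
Qed.

Theorem theorem2 : forall (a b r v : R),
  0 < a -> 0 < b -> 0 <= v <= 1 ->
  ((a <= b /\ 0 <= r) \/ (b <= a /\ r <= 0) ->
     a * g_bound r v a b <= heron_mean r v a b <= a * G_bound r v a b)
  /\
  ((a <= b /\ r <= 0) \/ (b <= a /\ 0 <= r) ->
     a * G_bound r v a b <= heron_mean r v a b <= a * g_bound r v a b).
Proof.
intros a b r v Ha Hb Hv.
pose proof (heron_sub_g_bound a b r v Ha Hb) as Hg.
pose proof (heron_sub_G_bound a b r v Ha Hb) as HG.
set (M := _ - (b - a) * (v * _)) in Hg.
set (T := _ - (b - a) * (_ / 2)) in HG.
assert (Hp : 0 < Rpower a (1 - v)) by apply exp_pos.
set (p := Rpower a (1 - v)) in *.
assert (Hle : a <= b -> 0 <= p * M /\ 0 <= p * - T).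
{ intros Hab.
  pose proof (Rpower_sub_bounds a b v Ha Hab Hv).
  split; apply Rmult_le_pos; unfold M, T; lra. }
assert (Hge : b <= a -> 0 <= p * - M /\ 0 <= p * T).
{ intros Hba.
  pose proof (Rpower_sub_bounds b a v Hb Hba Hv) as H.
  rewrite (Rplus_comm b a) in H.
  split; apply Rmult_le_pos; unfold M, T; lra. }
split; (intros [[Hab Hr] | [Hab Hr]];
  [destruct (Hle Hab) as [HM HT] | destruct (Hge Hab) as [HM HT]];
  split; nra).
Qed.
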